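(* Suppose that Assumption (A) (stated in the context) holds and let $\{(x^k,z^k,y^k)\}_{k\ge 0}$ be a sequence generated by Algorithm 1 or Algorithm 2. Suppose that one of the following conditions holds: (B-I) $A$ is invertible and $g$ is coercive; (B-II) $h$ is coercive. Then the sequence $\{(x^k,z^k,y^k)\}_{k\ge 0}$ is bounded.
   Context: Setting. All spaces $\mathbb{R}^N$ carry the Euclidean inner product $\langle\cdot,\cdot\rangle$ and norm $\|\cdot\|$; matrices carry the operator norm. $g\colon\mathbb{R}^m\to\mathbb{R}\cup\{+\infty\}$ is proper and lower semicontinuous, $h\colon\mathbb{R}^n\to\mathbb{R}$ is Fréchet differentiable with $L$-Lipschitz continuous gradient, $A\colon\mathbb{R}^n\to\mathbb{R}^m$ is linear with adjoint $A^*$; the optimization problem is $\min_{x\in\mathbb{R}^n}\{g(Ax)+h(x)\}$. For a symmetric matrix $M$ put $\|x\|_M^2:=\langle Mx,x\rangle$; $M\succcurlyeq M'$ means $\|x\|_M^2\ge\|x\|_{M'}^2$ for all $x$; $\mathrm{Id}$ is the identity matrix; $\lambda_{\min}$ denotes the smallest eigenvalue. A function $\Psi\colon\mathbb{R}^N\to\mathbb{R}\cup\{+\infty\}$ is coercive if $\lim_{\|x\|\to+\infty}\Psi(x)=+\infty$. Algorithms. Let $\{\mathbf{M}_1^k\}_{k\ge0}\subseteq\mathbb{R}^{n\times n}$, $\{\mathbf{M}_2^k\}_{k\ge0}\subseteq\mathbb{R}^{m\times m}$ be sequences of symmetric positive semidefinite matrices, $r>0$, $0<\rho<2$, and $(x^0,z^0,y^0)\in\mathbb{R}^n\times\mathbb{R}^m\times\mathbb{R}^m$.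 Both algorithms generate, for every $k\ge0$, $$z^{k+1}\in\arg\min_{z\in\mathbb{R}^m}\Big\{g(z)+\langle y^k,Ax^k-z\rangle+\tfrac r2\|Ax^k-z\|^2+\tfrac12\|z-z^k\|_{\mathbf{M}_2^k}^2\Big\},$$ then $x^{k+1}$, then $y^{k+1}:=y^k+\rho r(Ax^{k+1}-z^{k+1})$, where in Algorithm 1 $$x^{k+1}\in\arg\min_{x\in\mathbb{R}^n}\Big\{h(x)+\langle y^k,Ax-z^{k+1}\rangle+\tfrac r2\|Ax-z^{k+1}\|^2+\tfrac12\|x-x^k\|_{\mathbf{M}_1^k}^2\Big\},$$ and in Algorithm 2 $$x^{k+1}\in\arg\min_{x\in\mathbb{R}^n}\Big\{\langle x-x^k,\nabla h(x^k)\rangle+\langle y^k,Ax-z^{k+1}\rangle+\tfrac r2\|Ax-z^{k+1}\|^2+\tfrac12\|x-x^k\|_{\mathbf{M}_1^k}^2\Big\}.$$ Assumption (A). (i) $g$ and $h$ are bounded from below; (ii) $A$ is surjective, and we set $T_0:=\frac{1}{\lambda_{\min}(AA^* )\rho}$ if $0<\rho\le1$, $T_0:=\frac{\rho}{\lambda_{\min}(AA^* )(2-\rho)^2}$ if $1<\rho<2$; (iii) $\mu_1:=\sup_{k\ge0}\|\mathbf{M}_1^k\|<+\infty$ and $\mu_2:=\sup_{k\ge0}\|\mathbf{M}_2^k\|<+\infty$; (iv) $r>0$, $\rho\in(0,2)$ and $\mu_1\ge0$ are such that $r\ge4T_0L>0$ and $2\mathbf{M}_1^k+rA^*A\succcurlyeq\big(L+\frac{C_{\mathbf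 M}}{r}\big)\mathrm{Id}$ for all $k\ge0$, where $C_{\mathbf M}:=(6\mu_1^2+4(L+\mu_1)^2)T_0$ for Algorithm 1 and $C_{\mathbf M}:=(4\mu_1^2+6(L+\mu_1)^2)T_0$ for Algorithm 2. *)

(* Defs.v *)
(* R^N is 'cV[R]_N over an arbitrary R : realType. *)
From HB Require Import structures.
From mathcomp Require Import all_boot all_order all_algebra.
From mathcomp Require Import all_classical all_reals all_analysis.

Set Implicit Arguments.
Unset Strict Implicit.
Unset Printing Implicit Defensive.

Import Order.TTheory GRing.Theory Num.Theory.
Import numFieldNormedType.Exports.

Local Open Scope classical_set_scope.
Local Open Scope ring_scope.

(* The library norm `|x| on 'cV[R]_N is the sup norm, so the Euclidean
   structure is introduced separately. *)
Definition dotp (R : realType) (N : nat) (u v : 'cV[R]_N) : R :=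
  \sum_(i < N) u i 0 * v i 0.

Definition enorm (R : realType) (N : nat) (u : 'cV[R]_N) : R :=
  Num.sqrt (dotp u u).

Definition mxsqnorm (R : realType) (N : nat) (M : 'M[R]_N) (u : 'cV[R]_N) : R :=
  dotp (M *m u) u.

Definition mxsucceq (R : realType) (N : nat) (M M' : 'M[R]_N) : Prop :=
  forall u : 'cV[R]_N, mxsqnorm M' u <= mxsqnorm M u.

Definition sym_psd (R : realType) (N : nat) (M : 'M[R]_N) : Prop :=
  M^T = M /\ mxsucceq M 0.

Definition opnorm (R : realType) (p q : nat) (M : 'M[R]_(p, q)) : R :=
  sup [set enorm (M *m u) | u in [set u : 'cV[R]_q | enorm u <= 1]].

(* Only meant for symmetric M of positive size: the set of eigenvalues is then
   finite and nonempty, and the infimum is a minimum. *)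
Definition lambda_min (R : realType) (N : nat) (M : 'M[R]_N) : R :=
  inf [set a : R | eigenvalue M a].

Definition grad (R : realType) (N : nat) (h : 'cV[R]_N -> R) (u : 'cV[R]_N) :
    'cV[R]_N :=
  \col_i 'D_(delta_mx i 0) h u.

(* Fréchet differentiability does not depend on the choice of norm on R^N, so
   the library notion (for the sup norm) is the Euclidean one; grad represents
   the differential through the Euclidean inner product. *)
Lemma diff_grad (R : realType) (N : nat) (h : 'cV[R]_N -> R) (u v : 'cV[R]_N) :
  differentiable h u -> 'd h u v = dotp (grad h u) v.
Proof.
move=> dh; rewrite {1}(matrix_sum_delta v) linear_sum /dotp.
apply: eq_bigr => i _; rewrite big_ord1 linearZ /= mxE deriveE //.
by rewrite mulrC.
Qed.

Definition proper_fun (R : realType) (N : nat) (g : 'cV[R]_N -> \bar R) : Prop :=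
  (forall u, g u != -oo%E) /\ exists u, g u != +oo%E.

Definition bounded_below (R : realType) (N : nat) (g : 'cV[R]_N -> \bar R) : Prop :=
  exists c : R, forall u, (c%:E <= g u)%E.

Definition coercive (R : realType) (N : nat) (g : 'cV[R]_N -> \bar R) : Prop :=
  forall a : R, exists b : R, forall u, b < enorm u -> (a%:E < g u)%E.

Definition lipschitz_grad (R : realType) (N : nat) (h : 'cV[R]_N -> R) (L : R) :
    Prop :=
  forall u v, enorm (grad h u - grad h v) <= L * enorm (u - v).

Definition argmin (d : Order.disp_t) (T : Type) (Y : porderType d) (F : T -> Y) :
    set T :=
  [set t | forall s, (F t <= F s)%O].

Inductive algorithm := Alg1 | Alg2.

Definition z_objective (R : realType) (m n : nat) (g : 'cV[R]_m -> \bar R)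
    (A : 'M[R]_(m, n)) (r : R) (M2k : 'M[R]_m)
    (xk : 'cV[R]_n) (zk yk : 'cV[R]_m) (z : 'cV[R]_m) : \bar R :=
  (g z + (dotp yk (A *m xk - z) + r / 2 * enorm (A *m xk - z) ^+ 2
          + 2^-1 * mxsqnorm M2k (z - zk))%:E)%E.

Definition smooth_part (R : realType) (n : nat) (alg : algorithm)
    (h : 'cV[R]_n -> R) (xk x : 'cV[R]_n) : R :=
  match alg with
  | Alg1 => h x
  | Alg2 => dotp (x - xk) (grad h xk)
  end.

Definition x_objective (R : realType) (m n : nat) (alg : algorithm)
    (h : 'cV[R]_n -> R) (A : 'M[R]_(m, n)) (r : R) (M1k : 'M[R]_n)
    (xk : 'cV[R]_n) (zk1 yk : 'cV[R]_m) (x : 'cV[R]_n) : R :=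
  smooth_part alg h xk x + dotp yk (A *m x - zk1)
  + r / 2 * enorm (A *m x - zk1) ^+ 2 + 2^-1 * mxsqnorm M1k (x - xk).

Definition generated_by (R : realType) (m n : nat) (alg : algorithm)
    (g : 'cV[R]_m -> \bar R) (h : 'cV[R]_n -> R) (A : 'M[R]_(m, n))
    (M1 : nat -> 'M[R]_n) (M2 : nat -> 'M[R]_m) (r rho : R)
    (x : nat -> 'cV[R]_n) (z y : nat -> 'cV[R]_m) : Prop :=
  forall k : nat,
    [/\ argmin (z_objective g A r (M2 k) (x k) (z k) (y k)) (z k.+1),
        argmin (x_objective alg h A r (M1 k) (x k) (z k.+1) (y k)) (x k.+1)
      & y k.+1 = y k + (rho * r) *: (A *m x k.+1 - z k.+1)].

Definition T0 (R : realType) (m n : nat) (A : 'M[R]_(m, n)) (rho : R) : R :=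
  if rho <= 1 then 1 / (lambda_min (A *m A^T) * rho)
  else rho / (lambda_min (A *m A^T) * (2 - rho) ^+ 2).

Definition opnorms (R : realType) (N : nat) (M : nat -> 'M[R]_N) : set R :=
  range (fun k => opnorm (M k)).

Definition C_M (R : realType) (alg : algorithm) (L mu1 t0 : R) : R :=
  match alg with
  | Alg1 => (6 * mu1 ^+ 2 + 4 * (L + mu1) ^+ 2) * t0
  | Alg2 => (4 * mu1 ^+ 2 + 6 * (L + mu1) ^+ 2) * t0
  end.

(* The constants mu_1 and mu_2 are sup (opnorms M1) and sup (opnorms M2); their
   finiteness is the pair of has_ubound clauses.  Both dimensions are forced to
   be positive: for m = 0, lambda_min is inf set0 = 0, so T0 A rho = 0 and
   0 < 4 * t0 * L fails; for n = 0, surjectivity of A implies m = 0. *)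
Definition assumptionA (R : realType) (m n : nat) (alg : algorithm)
    (g : 'cV[R]_m -> \bar R) (h : 'cV[R]_n -> R) (A : 'M[R]_(m, n))
    (M1 : nat -> 'M[R]_n) (M2 : nat -> 'M[R]_m) (L r rho : R) : Prop :=
  let t0 := T0 A rho in
  let mu1 := sup (opnorms M1) in
  [/\ bounded_below g /\ bounded_below (EFin \o h),
      forall w : 'cV[R]_m, exists u : 'cV[R]_n, A *m u = w,
      has_ubound (opnorms M1) /\ has_ubound (opnorms M2)
    & [/\ 0 < r, 0 < rho < 2, 0 < 4 * t0 * L <= r
        & forall k, mxsucceq (2 *: M1 k + r *: (A^T *m A))
                             ((L + C_M alg L mu1 t0 / r)%:M)]].

(* The bound is for the Euclidean norm on R^n x R^m x R^m = R^(n + (m + m)). *)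
Definition bounded_triples (R : realType) (m n : nat)
    (x : nat -> 'cV[R]_n) (z y : nat -> 'cV[R]_m) : Prop :=
  exists C : R, forall k, enorm (col_mx (x k) (col_mx (z k) (y k))) <= C.

(* Main.v *)
Require Import Defs.
From HB Require Import structures.
From mathcomp Require Import all_boot all_order all_algebra.
From mathcomp Require Import all_classical all_reals all_analysis.
From mathcomp Require Import ring lra.
Import Order.TTheory GRing.Theory Num.Theory.
Import numFieldNormedType.Exports.
Set Implicit Arguments.
Unset Strict Implicit.
Unset Printing Implicit Defensive.
Local Open Scope classical_set_scope.
Local Open Scope ring_scope.

(** Boundedness comes from a merit function that decreases along the iterates
    and dominates every quantity of interest.

    Each iteration changes the augmented Lagrangian in three ways. The [z]-step
    does not increase it ([z_step]). The [x]-step decreases it by a quadratic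
    form in the step [d k = x k.+1 - x k] ([x_step]). The multiplier step
    increases it by [|y k.+1 - y k|^2 / (rho r)] ([y_step]). The increase is
    controlled through [A^T], which is bounded below by the smallest eigenvalue
    of [A A^T] ([lambda_min_gram]): the stationarity of the [x]-step
    ([x_step_stationary]) expresses [A^T y] by a relaxed recursion driven by
    gradients of [h] and proximal terms, which are Lipschitz in the steps. The
    convexity estimate [relax_step] bounds the increase by a telescoping term
    plus multiples of [|d k|^2] and [|d k.+1|^2]. Adding the telescoping terms
    to the Lagrangian gives [merit], and the assumption on
    [2 M_1^k + r A^T A] is what makes it decrease ([merit_decreases]).

    Conversely, completing the square leaves the single negative term
    [- |y|^2 / (2 r)] in the Lagrangian. The second convexity estimate
    [relax_bound] bounds [|A^T y|^2] by the corrections contained in [merit]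
    and by [|grad h|^2], which is at most [2 L (h - inf h)] ([grad_sq_le]).
    Since [r >= 4 T0 L], half of the corrections and half of [h] are left over
    ([merit_lower_bound]). Hence [g (z k)], [h (x k)], the multipliers and the
    residuals [A x k - z k] are all bounded. Coercivity of [h] bounds [x], and
    the residual then bounds [z]; coercivity of [g] bounds [z], and the residual
    together with the invertibility of [A] then bounds [x].

    Both algorithms are treated at once: they differ only in the point where the
    gradient is evaluated ([grad_point]) and in the step to which the Lipschitz
    constant of the gradient is charged ([prev_coef], [next_coef]). *)

(** * The Euclidean structure *)

Section Euclid.
Variable R : realType.

Section Dotp.
Variable N : nat.
Implicit Types (u v w : 'cV[R]_N) (a b : R).

Lemma dotpC u v : dotp u v = dotp v u.
Proof. by apply: eq_bigr => i _; rewrite mulrC. Qed.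

Lemma dotpDl u v w : dotp (u + v) w = dotp u w + dotp v w.
Proof. by rewrite -big_split; apply: eq_bigr => i _; rewrite mxE mulrDl. Qed.

Lemma dotpZl a u v : dotp (a *: u) v = a * dotp u v.
Proof. by rewrite big_distrr; apply: eq_bigr => i _; rewrite mxE -mulrA. Qed.

Lemma dotp0l u : dotp 0 u = 0.
Proof. by rewrite -[0 : 'cV_N](scale0r u) dotpZl mul0r. Qed.

Lemma dotpDr u v w : dotp w (u + v) = dotp w u + dotp w v.
Proof. by rewrite dotpC dotpDl !(dotpC _ w). Qed.

Lemma dotpZr a u v : dotp u (a *: v) = a * dotp u v.
Proof. by rewrite dotpC dotpZl dotpC. Qed.

Lemma dotpNl u v : dotp (- u) v = - dotp u v.
Proof. by rewrite -scaleN1r dotpZl mulN1r. Qed.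

Lemma dotpNr u v : dotp u (- v) = - dotp u v.
Proof. by rewrite dotpC dotpNl dotpC. Qed.

Lemma mxsqnorm0 u : mxsqnorm 0 u = 0.
Proof. by rewrite /mxsqnorm mul0mx dotp0l. Qed.

Definition dotpE := (dotpDl, dotpDr, dotpNl, dotpNr, dotpZl, dotpZr).

Lemma dotp_mulmxl p q (M : 'M[R]_(p, q)) (u : 'cV[R]_q) (v : 'cV[R]_p) :
  dotp (M *m u) v = dotp u (M^T *m v).
Proof.
rewrite /dotp; under eq_bigr do rewrite mxE mulr_suml.
rewrite exchange_big; apply: eq_bigr => i _; rewrite mxE mulr_sumr.
by apply: eq_bigr => j _; rewrite mxE; ring.
Qed.

Lemma dotp_ge0 u : 0 <= dotp u u.
Proof. by apply: sumr_ge0 => i _; rewrite -expr2 sqr_ge0. Qed.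

Lemma dotp_eq0 u : dotp u u = 0 -> u = 0.
Proof.
move=> /eqP; rewrite psumr_eq0 => [/allP u0|i _]; last by rewrite -expr2 sqr_ge0.
apply/colP => i; rewrite mxE; apply/eqP.
by have := u0 i (mem_index_enum i); rewrite mulf_eq0 orbb.
Qed.

Lemma sqr_enorm u : enorm u ^+ 2 = dotp u u.
Proof. by rewrite sqr_sqrtr ?dotp_ge0. Qed.

Lemma enorm_ge0 u : 0 <= enorm u.
Proof. exact: sqrtr_ge0. Qed.

Lemma enorm_le u b : 0 <= b -> (enorm u <= b) = (dotp u u <= b ^+ 2).
Proof. by move=> b0; rewrite -sqr_enorm ler_pXn2r ?nnegrE ?enorm_ge0. Qed.

Lemma enormZ a u : enorm (a *: u) = `|a| * enorm u.
Proof. by rewrite /enorm !dotpE mulrA -expr2 sqrtrM ?sqr_ge0// sqrtr_sqr. Qed.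

Lemma enormN u : enorm (- u) = enorm u.
Proof. by rewrite -scaleN1r enormZ normrN1 mul1r. Qed.

Lemma enorm0 : enorm (0 : 'cV[R]_N) = 0.
Proof. by rewrite /enorm dotp0l sqrtr0. Qed.

(** Evaluate the quadratic at its minimizer [- b / c]; when [c = 0], an affine
    function that stays nonnegative must be constant. *)
Lemma discriminant_le0 a b c : 0 <= c ->
  (forall t, 0 <= a + 2 * t * b + t ^+ 2 * c) -> b ^+ 2 <= a * c.
Proof.
rewrite le_eqVlt => /predU1P[<-|c0] q.
  have [-> |b0] := eqVneq b 0; first by rewrite expr0n mulr0.
  have := q (- (a + 1) / (2 * b)); rewrite mulr0 addr0.
  have -> : 2 * (- (a + 1) / (2 * b)) * b = - (a + 1) by field.
  by lra.
have := q (- b / c); rewrite -ler_pdivrMr//.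
have -> : a + 2 * (- b / c) * b + (- b / c) ^+ 2 * c = a - b ^+ 2 / c.
  by field; rewrite gt_eqF.
by rewrite subr_ge0.
Qed.

Lemma form_cauchy_schwarz (S : 'M[R]_N) u v : sym_psd S ->
  dotp (S *m u) v ^+ 2 <= dotp (S *m u) u * dotp (S *m v) v.
Proof.
move=> [Ssym Spsd].
have form_ge0 w : 0 <= dotp (S *m w) w.
  apply: le_trans (Spsd w).
  by rewrite mxsqnorm0.
have Sadj w w' : dotp (S *m w) w' = dotp (S *m w') w.
  by rewrite dotp_mulmxl Ssym dotpC.
apply: discriminant_le0 (form_ge0 v) _ => t.
have := form_ge0 (u + t *: v).
by rewrite mulmxDr -scalemxAr !dotpE (Sadj v u); congr (0 <= _); ring.
Qed.

Lemma cauchy_schwarz u v : dotp u v ^+ 2 <= dotp u u * dotp v v.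
Proof.
have := @form_cauchy_schwarz 1%:M u v; rewrite !mul1mx; apply; split.
  exact: trmx1.
move=> w; rewrite mxsqnorm0 /mxsqnorm mul1mx.
exact: dotp_ge0.
Qed.

Lemma dotp_le u v : dotp u v <= enorm u * enorm v.
Proof.
apply: le_trans (ler_norm _) _.
rewrite -(@ler_pXn2r _ 2) ?nnegrE ?mulr_ge0 ?enorm_ge0//.
by rewrite real_normK ?num_real// exprMn !sqr_enorm cauchy_schwarz.
Qed.

Lemma enormD u v : enorm (u + v) <= enorm u + enorm v.
Proof.
rewrite enorm_le ?addr_ge0 ?enorm_ge0// !dotpE (dotpC v u) sqrrD !sqr_enorm.
by have := dotp_le u v; lra.
Qed.

Lemma enorm_sum (I : Type) (s : seq I) (F : I -> 'cV[R]_N) :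
  enorm (\sum_(i <- s) F i) <= \sum_(i <- s) enorm (F i).
Proof.
elim: s => [|i s IHs]; first by rewrite !big_nil enorm0.
by rewrite !big_cons (le_trans (enormD _ _))// lerD2l.
Qed.

Lemma coord_le_enorm u i : `|u i 0| <= enorm u.
Proof.
rewrite -sqrtr_sqr ler_wsqrtr// /dotp (bigD1 i)//= -expr2 lerDl.
by apply: sumr_ge0 => j _; rewrite -expr2 sqr_ge0.
Qed.

Lemma sq_convex a b u v : 0 <= a -> 0 <= b -> a + b = 1 ->
  dotp (a *: u + b *: v) (a *: u + b *: v) <= a * dotp u u + b * dotp v v.
Proof.
move=> a0 b0 ab; rewrite !dotpE (dotpC v u).
have -> : b = 1 - a by rewrite -ab addrAC subrr add0r.
have : 0 <= a * (1 - a) * dotp (u - v) (u - v).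
  by rewrite mulr_ge0 ?dotp_ge0// mulr_ge0//; lra.
by rewrite !dotpE (dotpC v u); lra.
Qed.

Lemma sq_addr_le u v : dotp (u + v) (u + v) <= 2 * dotp u u + 2 * dotp v v.
Proof.
by have := dotp_ge0 (u - v); rewrite !dotpE (dotpC v u); lra.
Qed.

Lemma dotp_col_mx (N' : nat) u (u' : 'cV[R]_N') :
  dotp (col_mx u u') (col_mx u u') = dotp u u + dotp u' u'.
Proof.
rewrite /dotp big_split_ord; congr (_ + _); apply: eq_bigr => i _.
  by rewrite col_mxEu.
by rewrite col_mxEd.
Qed.

End Dotp.

Lemma enorm_le_sq p q (a : 'cV[R]_p) (b : 'cV[R]_q) (c : R) : 0 <= c ->
  enorm a <= c * enorm b -> dotp a a <= c ^+ 2 * dotp b b.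
Proof.
move=> c0; rewrite -(sqr_enorm b) -exprMn enorm_le//.
by rewrite mulr_ge0// enorm_ge0.
Qed.

(** The first iterate is arbitrary: [g (z 0)] may be infinite, so the estimates
    only concern positive indices. *)
Lemma bounded_up_to_index N (s : nat -> 'cV[R]_N) :
  (exists C, forall k, enorm (s k.+1) <= C) -> exists C, forall k, enorm (s k) <= C.
Proof.
move=> [C sC]; exists (Num.max (enorm (s 0)) C) => -[|k].
  by rewrite le_max lexx.
by rewrite le_max sC orbT.
Qed.

(** * Operator norms and the smallest eigenvalue *)

Lemma mulmx_bounded p q (M : 'M[R]_(p, q)) :
  exists2 K, 0 <= K & forall u, enorm (M *m u) <= K * enorm u.
Proof.
exists (\sum_i enorm (col i M)) => [|u].
  by apply: sumr_ge0 => i _; exact: enorm_ge0.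
have -> : M *m u = \sum_i u i 0 *: col i M.
  apply/colP => j; rewrite mxE summxE; apply: eq_bigr => i _.
  by rewrite !mxE mulrC.
rewrite (le_trans (enorm_sum _ _))// mulr_suml ler_sum// => i _.
by rewrite enormZ mulrC ler_wpM2l ?enorm_ge0// coord_le_enorm.
Qed.

Lemma opnorm_bound p q (M : 'M[R]_(p, q)) u :
  enorm (M *m u) <= opnorm M * enorm u.
Proof.
have [K K0 MK] := mulmx_bounded M.
have ub w : enorm w <= 1 -> enorm (M *m w) <= opnorm M.
  move=> w1; apply: ub_le_sup; last by exists w.
  exists K => _ [v /= v1 <-]; apply: le_trans (MK v) _.
  by rewrite ler_piMr.
have [u0|u0] := eqVneq (enorm u) 0.
  by have := MK u; rewrite u0 !mulr0.
have u_gt0 : 0 < enorm u by rewrite lt_neqAle eq_sym u0 enorm_ge0.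
have := ub ((enorm u)^-1 *: u).
rewrite -scalemxAr !enormZ ger0_norm ?invr_ge0 ?enorm_ge0// mulVf// mulrC.
by rewrite ler_pdivrMr//; apply.
Qed.

Lemma opnorm_ge0 p q (M : 'M[R]_(p, q)) : 0 <= opnorm M.
Proof.
have [K K0 MK] := mulmx_bounded M.
apply: ub_le_sup; last by exists 0; rewrite /= ?mulmx0 enorm0.
exists K => _ [v /= v1 <-]; apply: le_trans (MK v) _.
by rewrite ler_piMr.
Qed.

Lemma eigenvalue_gram_ge0 m n (A : 'M[R]_(m, n)) a :
  eigenvalue (A *m A^T) a -> 0 <= a.
Proof.
move=> /eigenvalueP[v vA v0].
have vv : 0 < dotp v^T v^T.
  rewrite lt_neqAle dotp_ge0 andbT eq_sym; apply: contraNneq v0 => /dotp_eq0.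
  by move=> /(congr1 trmx); rewrite trmxK trmx0 => ->.
have : 0 <= dotp (A^T *m v^T) (A^T *m v^T) by exact: dotp_ge0.
rewrite dotp_mulmxl trmxK mulmxA.
have -> : A *m A^T *m v^T = a *: v^T.
  by apply: trmx_inj; rewrite !trmx_mul !trmxK vA linearZ /= trmxK.
by rewrite dotpZr pmulr_lge0.
Qed.

Lemma lambda_min_gram_ge0 m n (A : 'M[R]_(m, n)) : 0 <= lambda_min (A *m A^T).
Proof.
rewrite /lambda_min; set E := [set _ | _].
have [->|/set0P E0] := eqVneq E set0; first by rewrite inf0.
by apply: lb_le_inf => // a; exact: eigenvalue_gram_ge0.
Qed.

(** The infimum [c] of the Rayleigh quotient of [A *m A^T] is an eigenvalue:
    [S := A *m A^T - c] is positive semidefinite, and if it were invertible,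
    the Cauchy-Schwarz inequality of the form [S] for [w] and [S^-1 w] would
    bound [<S w, w>] below by a positive multiple of [|w|^2]. *)
Lemma lambda_min_gram m n (A : 'M[R]_(m, n)) w :
  lambda_min (A *m A^T) * dotp w w <= dotp (A^T *m w) (A^T *m w).
Proof.
pose Q (v : 'cV[R]_m) := dotp (A^T *m v) (A^T *m v).
have [-> |w0] := eqVneq w 0.
  by rewrite dotp0l mulr0 dotp_ge0.
have sq_gt0 (v : 'cV[R]_m) : v != 0 -> 0 < dotp v v.
  move=> v0; rewrite lt_neqAle dotp_ge0 andbT eq_sym.
  by apply: contraNneq v0 => /dotp_eq0 ->.
pose Ray := [set Q v / dotp v v | v in [set v | v != 0]].
have Ray_lb : has_lbound Ray.
  by exists 0 => _ [v _ <-]; rewrite divr_ge0 ?dotp_ge0.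
have Ray0 : Ray !=set0 by exists (Q w / dotp w w); exists w.
pose c := inf Ray.
have cQ v : c * dotp v v <= Q v.
  have [-> |v0] := eqVneq v 0.
    by rewrite dotp0l mulr0 dotp_ge0.
  by rewrite -ler_pdivlMr ?sq_gt0//; apply: ge_inf => //; exists v.
pose S : 'M[R]_m := A *m A^T - c%:M.
have SE v : dotp (S *m v) v = Q v - c * dotp v v.
  rewrite mulmxBl mul_scalar_mx !dotpE -mulmxA dotp_mulmxl; congr (_ - _).
have S_psd : sym_psd S.
  split; first by rewrite /S linearB /= trmx_mul trmxK tr_scalar_mx.
  move=> v; rewrite mxsqnorm0 /mxsqnorm SE.
  by rewrite subr_ge0.
have S_sing : S \notin unitmx.
  apply/negP => S_unit.
  have [K K0 SK] := mulmx_bounded (invmx S).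
  have K1 : 0 < K + 1 by rewrite ltr_wpDl.
  suff : c + (K + 1)^-1 <= c by rewrite gerDl leNgt invr_gt0 K1.
  apply: lb_le_inf => // _ [v /= v0 <-].
  have vv := sq_gt0 v v0.
  rewrite ler_pdivlMr// mulrDl -lerBrDl -SE ler_pdivrMl//.
  have := form_cauchy_schwarz v (invmx S *m v) S_psd.
  rewrite {1}dotp_mulmxl (proj1 S_psd) mulKVmx// expr2 => cs.
  have Sv0 : 0 <= dotp (S *m v) v by rewrite SE subr_ge0.
  have vw : dotp v (invmx S *m v) <= K * dotp v v.
    rewrite (le_trans (dotp_le _ _))// -sqr_enorm expr2 mulrCA.
    by rewrite ler_wpM2l ?enorm_ge0// mulrC.
  rewrite -(ler_pM2r vv); apply: le_trans cs _.
  apply: le_trans (ler_wpM2l Sv0 vw) _.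
  by rewrite mulrA (mulrC _ K) ler_wpM2r ?(ltW vv)// ler_wpM2r// lerDl.
apply: le_trans (cQ w); rewrite ler_wpM2r ?dotp_ge0//.
apply: ge_inf; first by exists 0 => a; exact: eigenvalue_gram_ge0.
rewrite /= /eigenvalue /eigenspace kermx_eq0.
by rewrite row_free_unit.
Qed.

End Euclid.

(** * Functions with a Lipschitz gradient *)

Section Smooth.
Variables (R : realType) (n : nat) (h : 'cV[R]_n -> R) (L : R).
Hypothesis h_diff : forall u, differentiable h u.

Lemma is_derive_line (u d : 'cV[R]_n) (t : R) :
  is_derive t 1 (fun s : R => h (u + s *: d)) (dotp (grad h (u + t *: d)) d).
Proof.
have E : (fun e : R => e^-1 *: (((fun s : R => h (u + s *: d)) \o shift t)
             (e *: (1 : R)) - h (u + t *: d)))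
       = (fun e : R => e^-1 *: ((h \o shift (u + t *: d)) (e *: d)
             - h (u + t *: d))).
  apply/funext => e /=; congr (_ *: (h _ - _)).
  by rewrite [e *: 1]mulr1 scalerDl addrCA.
split; first by rewrite /derivable E; exact: diff_derivable.
by rewrite /derive E -diff_grad// -deriveE.
Qed.

Hypothesis h_grad : lipschitz_grad h L.

(** Along the segment from [u], the derivative of [h] minus its linearization
    at time [t] is at most [L * t * |d|^2] in absolute value, by the Lipschitz
    bound. The factor [s] treats the upper and the lower estimate together. *)
Lemma descent (u d : 'cV[R]_n) :
  `|h (u + d) - h u - dotp (grad h u) d| <= L / 2 * dotp d d.
Proof.
have signed (s : R) : `|s| = 1 ->
    s * (h (u + d) - h u - dotp (grad h u) d) <= L / 2 * dotp d d.
  move=> s1.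
  pose f t := s * h (u + t *: d) - s * dotp (grad h u) d * t
              - L / 2 * dotp d d * t ^+ 2.
  pose df t := s * dotp (grad h (u + t *: d) - grad h u) d - L * dotp d d * t.
  have f' (t : R) : is_derive t (1 : R) f (df t).
    have := is_derive_line u d t; rewrite /df !dotpE.
    move: (dotp (grad h (u + t *: d)) d) => G hG.
    by rewrite /f; apply: is_derive_eq; rewrite /GRing.scale/=; field.
  have [|c c01] := @MVT_segment R f df 0 1 ler01 (fun t _ => f' t).
    apply: derivable_within_continuous => t _; exact: ex_derive.
  rewrite /f scale1r scale0r addr0 subr0 mulr1 => E.
  have : df c <= 0.
    rewrite /df subr_le0; move: c01; rewrite in_itv /= => /andP[c0 _].
    rewrite (le_trans (ler_norm _))// normrM s1 mul1r.
    have sch (a : 'cV[R]_n) : `|dotp a d| <= enorm a * enorm d.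
      by rewrite ler_norml lerNl -dotpNl -[enorm a in X in X && _]enormN !dotp_le.
    apply: le_trans (sch _) _.
    apply: le_trans (ler_wpM2r (enorm_ge0 _) (h_grad _ _)) _.
    rewrite addrAC subrr add0r enormZ ger0_norm// -sqr_enorm.
    by rewrite le_eqVlt; apply/orP; left; apply/eqP; ring.
  by move: E; rewrite expr0n/= !mulr0 expr1n; lra.
rewrite ler_norml; apply/andP; split.
  by have := signed (-1); rewrite normrN1 mulN1r => /(_ erefl); lra.
by have := signed 1; rewrite normr1 mul1r => /(_ erefl).
Qed.

Lemma descent_upper (u v : 'cV[R]_n) :
  h v <= h u + dotp (grad h u) (v - u) + L / 2 * dotp (v - u) (v - u).
Proof.
have := descent u (v - u); rewrite ler_norml [u + _]addrC subrK => /andP[_].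
by lra.
Qed.

Lemma descent_lower (u v : 'cV[R]_n) :
  h u + dotp (grad h u) (v - u) - L / 2 * dotp (v - u) (v - u) <= h v.
Proof.
have := descent u (v - u); rewrite ler_norml [u + _]addrC subrK => /andP[+ _].
by lra.
Qed.

(** A gradient step of length [1 / L] decreases [h] by [|grad h|^2 / (2 L)],
    and cannot go below the lower bound. *)
Lemma grad_sq_le (c : R) (u : 'cV[R]_n) : 0 < L -> (forall v, c <= h v) ->
  dotp (grad h u) (grad h u) <= 2 * L * (h u - c).
Proof.
move=> L0 hc; have := le_trans (hc _) (descent_upper u (u - L^-1 *: grad h u)).
have -> : u - L^-1 *: grad h u - u = - (L^-1 *: grad h u).
  by rewrite addrAC subrr add0r.
rewrite !dotpE; set q := dotp _ _ => le_c.
have : q / L <= 2 * (h u - c).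
  suff -> : q / L = 2 * (h u - (h u + - (L^-1 * q) + L / 2 * - (L^-1 * - (L^-1 * q)))).
    by lra.
  by field; rewrite gt_eqF.
by rewrite ler_pdivrMr// -mulrA (mulrC L) mulrA.
Qed.

End Smooth.

(** * The relaxed recursion of the multipliers *)

Section Relaxation.
Variables (R : realType) (rho : R).
Hypothesis rho02 : 0 < rho < 2.

(** The increments [p] of [A^T y] obey [p' = (1 - rho) p + rho q], where [q] is
    the change of the stationarity data. For [rho <= 1] this is a convex
    combination of [p] and [q]; for [1 < rho < 2] it is the convex combination
    of [- p] and [rho / (2 - rho) q] with weights [rho - 1] and [2 - rho].
    Jensen's inequality for the squared norm, rearranged to isolate
    [|p'|^2 / rho], yields a telescoping difference with coefficient
    [relax_memory] and a forcing term with coefficient [relax_input]. *)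
Definition relax_input : R :=
  if rho <= 1 then 1 / rho else rho / (2 - rho) ^+ 2.

Definition relax_memory : R :=
  if rho <= 1 then (1 - rho) / rho ^+ 2 else (rho - 1) / (rho * (2 - rho)).

Lemma T0_relax_input m n (A : 'M[R]_(m, n)) :
  T0 A rho = relax_input / lambda_min (A *m A^T).
Proof.
by rewrite /T0 /relax_input; case: ifP => _; rewrite invfM mulrA [RHS]mulrAC.
Qed.

Lemma relax_input_gt0 : 0 < relax_input.
Proof.
case/andP: rho02 => r0 r2; rewrite /relax_input; case: ifP => _.
  by rewrite divr_gt0.
by rewrite divr_gt0// exprn_gt0// subr_gt0.
Qed.

Lemma relax_memory_ge0 : 0 <= relax_memory.
Proof.
case/andP: rho02 => r0 r2; rewrite /relax_memory; case: (leP rho 1) => r1.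
  by rewrite divr_ge0 ?subr_ge0// exprn_ge0// ltW.
by rewrite divr_ge0 ?subr_ge0 ?ltW// mulr_gt0// subr_gt0.
Qed.

Variable N : nat.
Implicit Types p q : 'cV[R]_N.

Lemma relax_step p q p' : p' = (1 - rho) *: p + rho *: q ->
  dotp p' p' / rho <=
    relax_memory * (dotp p p - dotp p' p') + relax_input * dotp q q.
Proof.
case/andP: rho02 => r0 r2 p'E.
have rn0 : rho != 0 by rewrite gt_eqF.
rewrite /relax_memory /relax_input; case: (leP rho 1) => r1.
  have := @sq_convex _ _ (1 - rho) rho p q; rewrite -p'E.
  move=> cvx.
  have {}cvx : dotp p' p' <= (1 - rho) * dotp p p + rho * dotp q q.
    by apply: cvx; lra.
  rewrite -subr_ge0; set P := dotp p p in cvx *; set P' := dotp p' p' in cvx *.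
  set Q := dotp q q in cvx *.
  have -> : (1 - rho) / rho ^+ 2 * (P - P') + 1 / rho * Q - P' / rho =
            ((1 - rho) * P + rho * Q - P') / rho ^+ 2 by field.
  by rewrite divr_ge0 ?subr_ge0// exprn_ge0// ltW.
have s0 : 0 < 2 - rho by rewrite subr_gt0.
have sn0 : 2 - rho != 0 by rewrite gt_eqF.
have := @sq_convex _ _ (rho - 1) (2 - rho) (- p) ((rho / (2 - rho)) *: q).
have -> : (rho - 1) *: - p + (2 - rho) *: ((rho / (2 - rho)) *: q) = p'.
  rewrite p'E.
  by rewrite scalerA mulrCA divff// mulr1 scalerN -scaleNr opprB.
rewrite [dotp (- p) _]dotpNl [dotp p (- p)]dotpNr opprK !dotpZl !dotpZr => cvx.
have {}cvx : dotp p' p' <= (rho - 1) * dotp p p +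
    (2 - rho) * (rho / (2 - rho) * (rho / (2 - rho) * dotp q q)).
  by apply: cvx; lra.
rewrite -subr_ge0; set P := dotp p p in cvx *; set P' := dotp p' p' in cvx *.
set Q := dotp q q in cvx *.
have -> : (rho - 1) / (rho * (2 - rho)) * (P - P') +
    rho / (2 - rho) ^+ 2 * Q - P' / rho =
  ((rho - 1) * P + (2 - rho) * (rho / (2 - rho) * (rho / (2 - rho) * Q)) - P')
    / (rho * (2 - rho)).
  by field; rewrite sn0 rn0.
by rewrite divr_ge0 ?subr_ge0// mulr_ge0// ltW.
Qed.

(** With the same recursion the current value of [A^T y], rather than its
    increment, is [q + ((rho - 1) / rho) p] for the stationarity data [q]. The
    convex weights are now [1 - rho] and [rho] (or [(rho - 1) / rho] and
    [1 / rho] when [rho > 1]), and the coefficients that come out are at most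
    those of the telescoping estimate. That coincidence is what lets the
    telescoped terms absorb the multiplier in the lower bound. *)
Lemma relax_bound p q q' : q' = q + ((rho - 1) / rho) *: p ->
  dotp q' q' <= relax_memory * dotp p p + relax_input * dotp q q.
Proof.
case/andP: rho02 => r0 r2 q'E.
have rn0 : rho != 0 by rewrite gt_eqF.
rewrite /relax_memory /relax_input; case: (leP rho 1) => r1.
  have := @sq_convex _ _ (1 - rho) rho (- rho^-1 *: p) (rho^-1 *: q).
  have -> : (1 - rho) *: (- rho^-1 *: p) + rho *: (rho^-1 *: q) = q'.
    rewrite !scalerA divff// scale1r addrC q'E; congr (_ + _ *: _).
    by rewrite mulrN -mulNr opprB.
  rewrite !dotpZl !dotpZr => cvx.
  apply: le_trans (cvx _ _ _) _; [by lra|by lra|by lra|].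
  by rewrite le_eqVlt; apply/orP; left; apply/eqP; field.
have := @sq_convex _ _ ((rho - 1) / rho) rho^-1 p (rho *: q).
have -> : ((rho - 1) / rho) *: p + rho^-1 *: (rho *: q) = q'.
  by rewrite scalerA mulVf// scale1r addrC q'E.
rewrite !dotpZl !dotpZr mulKf// => cvx.
have ri : 0 < rho^-1 by rewrite invr_gt0.
apply: le_trans (cvx _ _ _) _.
- by rewrite mulr_ge0 ?ltW// subr_gt0.
- exact: ltW.
- by field.
have s0 : 0 < 2 - rho by rewrite subr_gt0.
have s1 : 1 <= (2 - rho)^-1 by rewrite invf_ge1//; lra.
rewrite lerD//.
  rewrite ler_wpM2r ?dotp_ge0// invfM mulrA ler_peMr// mulr_ge0 ?ltW//.
  by rewrite subr_gt0.
rewrite ler_wpM2r ?dotp_ge0// ler_peMr ?(ltW r0)// -exprVn expr_ge1//.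
by rewrite ltW// invr_gt0.
Qed.

End Relaxation.

(** * Descent of the merit function *)

Section Iteration.
Variables (R : realType) (m n : nat) (alg : algorithm).
Variables (g : 'cV[R]_m -> \bar R) (h : 'cV[R]_n -> R) (A : 'M[R]_(m, n)).
Variables (M1 : nat -> 'M[R]_n) (M2 : nat -> 'M[R]_m) (L r rho : R).
Variables (x : nat -> 'cV[R]_n) (z y : nat -> 'cV[R]_m).
Hypothesis g_proper : proper_fun g.
Hypothesis h_diff : forall u, differentiable h u.
Hypothesis h_grad : lipschitz_grad h L.
Hypothesis M1_psd : forall k, sym_psd (M1 k).
Hypothesis M2_psd : forall k, sym_psd (M2 k).
Hypothesis hA : assumptionA alg g h A M1 M2 L r rho.
Hypothesis hgen : generated_by alg g h A M1 M2 r rho x z y.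

Let lam := lambda_min (A *m A^T).
Let mu := sup (opnorms M1).

Let r_gt0 : 0 < r. Proof. by case: hA => _ _ _ []. Qed.

Let rho02 : 0 < rho < 2. Proof. by case: hA => _ _ _ []. Qed.

Let rho_gt0 : 0 < rho. Proof. by case/andP: rho02. Qed.

(* A zero smallest eigenvalue would make T0 vanish, against 0 < 4 T0 L. *)
Let lam_gt0 : 0 < lam.
Proof.
rewrite lt_neqAle lambda_min_gram_ge0 andbT eq_sym.
case: hA => _ _ _ [_ _ /andP[tL _] _]; apply: contraTneq tL => lam0.
by rewrite T0_relax_input -/lam lam0 invr0 mulr0 mulr0 mul0r ltxx.
Qed.

Let T0_gt0 : 0 < T0 A rho.
Proof. by rewrite T0_relax_input divr_gt0 ?relax_input_gt0. Qed.

Let L_gt0 : 0 < L.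
Proof.
by case: hA => _ _ _ [_ _ /andP[+ _] _]; rewrite pmulr_rgt0// mulr_gt0.
Qed.

Let mu_bound k u : enorm (M1 k *m u) <= mu * enorm u.
Proof.
apply: le_trans (opnorm_bound _ _) _; rewrite ler_wpM2r ?enorm_ge0//.
by apply: ub_le_sup; [case: hA => _ _ []|exists k].
Qed.

Let mu_ge0 : 0 <= mu.
Proof.
apply: le_trans (opnorm_ge0 (M1 0)) _.
by apply: ub_le_sup; [case: hA => _ _ []|exists 0].
Qed.

Let d k := x k.+1 - x k.
Let res k := A *m x k - z k.

(** The stationarity condition of the exact [x]-step involves the gradient at
    the new point, that of the linearized one at the old point. *)
Definition grad_point k := if alg is Alg1 then x k.+1 else x k.

(* The value that the x-step prescribes for A^T (y + r (A x - z)). *)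
Let w k := - grad h (grad_point k) - M1 k *m d k.

(** The Lipschitz inequality replaces differentiation: along a ray from the
    minimizer the objective is at most a quadratic in the step length whose
    linear coefficient must then vanish. *)
Lemma x_step_stationary k :
  A^T *m (y k + r *: (A *m x k.+1 - z k.+1)) = w k.
Proof.
pose q := A *m x k.+1 - z k.+1.
have [G Gdef] : exists G, G = A^T *m (y k + r *: q) - w k by eexists.
suff : dotp G G ^+ 2 <= 0 * (L * dotp G G + r * dotp (A *m G) (A *m G)
                             + dotp (M1 k *m G) G).
  rewrite mul0r => G2; apply: subr0_eq; rewrite -Gdef; apply: dotp_eq0.
  by apply/eqP; rewrite -sqrf_eq0 eq_le G2 sqr_ge0.
have MG : 0 <= dotp (M1 k *m G) G.
  by case: (M1_psd k) => _ /(_ G); rewrite mxsqnorm0.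
apply: discriminant_le0.
  by rewrite addr_ge0// addr_ge0// mulr_ge0 ?dotp_ge0// ltW.
move=> t; case: (hgen k) => _ xmin _.
have := xmin (x k.+1 + t *: G).
rewrite /x_objective !sqr_enorm /mxsqnorm.
have -> : A *m (x k.+1 + t *: G) - z k.+1 = q + t *: (A *m G).
  by rewrite mulmxDr -scalemxAr addrAC.
have -> : x k.+1 + t *: G - x k = d k + t *: G by rewrite addrAC.
(* Opaque copies stop the bilinearity rewrites from splitting differences. *)
have [dk dkE] : exists v, v = d k by eexists.
have [q' q'E] : exists v, v = q by eexists.
rewrite -/q -/(d k) [M1 k *m (d k + _)]mulmxDr -scalemxAr -dkE -q'E.
have smooth : smooth_part alg h (x k) (x k.+1 + t *: G) <=
    smooth_part alg h (x k) (x k.+1)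
    + t * dotp (grad h (grad_point k)) G + L / 2 * t ^+ 2 * dotp G G.
  rewrite /smooth_part /grad_point; case: alg.
    have := descent_upper h_diff h_grad (x k.+1) (x k.+1 + t *: G).
    by rewrite [_ + _ - x k.+1]addrAC subrr add0r !dotpE; lra.
  have : 0 <= L / 2 * t ^+ 2 * dotp G G.
    by rewrite mulr_ge0 ?dotp_ge0// mulr_ge0 ?sqr_ge0// divr_ge0// ltW.
  by rewrite !dotpE (dotpC G); lra.
have MdG : dotp (M1 k *m G) dk = dotp (M1 k *m dk) G.
  by rewrite dotp_mulmxl (proj1 (M1_psd k)) dotpC.
have GE : dotp G G = dotp (grad h (grad_point k)) G + dotp (y k) (A *m G)
     + r * dotp q' (A *m G) + dotp (M1 k *m dk) G.
  by rewrite {1}Gdef /w -q'E -dkE !dotpE dotp_mulmxl trmxK !dotpE; ring.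
rewrite !dotpE MdG (dotpC (A *m G) q').
move: smooth; rewrite GE; lra.
Qed.

Let yE k : y k.+1 = y k + (rho * r) *: res k.+1.
Proof. by case: (hgen k). Qed.

Let p k := A^T *m (y k.+1 - y k).

Lemma multiplier_relaxation k :
  A^T *m y k.+1 = (1 - rho) *: (A^T *m y k) + rho *: w k.
Proof.
rewrite -x_step_stationary yE !mulmxDr -!scalemxAr scalerDr !scalerA addrA.
by rewrite -scalerDl subrK scale1r.
Qed.

Lemma increment_relaxation k :
  p k.+1 = (1 - rho) *: p k + rho *: (w k.+1 - w k).
Proof.
rewrite /p mulmxBr (multiplier_relaxation k.+1) {2}(multiplier_relaxation k).
by rewrite mulmxBr !scalerBr opprD addrACA.
Qed.

(** Eliminating the old multiplier from the recursion leaves the last increment,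
    which the merit function controls. *)
Lemma multiplier_from_increment k :
  A^T *m y k.+1 = w k + ((rho - 1) / rho) *: p k.
Proof.
rewrite /p mulmxBr multiplier_relaxation.
move: (A^T *m y k) (w k) => a b; apply/colP => i; rewrite !mxE.
by field; rewrite gt_eqF.
Qed.

(** In [w k.+1 - w k] the proximal terms contribute [mu] times each of the two
    steps [d k] and [d k.+1], and the gradients contribute [L] times one of
    them: the current step [d k.+1] for the algorithm with the exact [h], the
    previous step [d k] for the linearized one. Splitting the constants by step
    makes the two algorithms indistinguishable from here on. *)
Definition prev_coef := if alg is Alg1 then mu ^+ 2 else (L + mu) ^+ 2.
Definition next_coef := if alg is Alg1 then (L + mu) ^+ 2 else mu ^+ 2.

(** Of the budget [6 prev_coef + 4 next_coef], the share [4 (prev_coef +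
    next_coef)] pays for the change of the multiplier; the rest is spare. *)
Lemma C_M_coefs t : C_M alg L mu t = (6 * prev_coef + 4 * next_coef) * t.
Proof. by rewrite /prev_coef /next_coef /C_M; case: alg; lra. Qed.

Lemma prev_coef_ge0 : 0 <= prev_coef.
Proof. by rewrite /prev_coef; case: alg; rewrite /= sqr_ge0. Qed.

Lemma grad_prox_sq k u v b a : a = grad h u - grad h v - M1 k *m b ->
  enorm (u - v) = enorm b -> dotp a a <= (L + mu) ^+ 2 * dotp b b.
Proof.
move=> -> uv; apply: enorm_le_sq; first by rewrite addr_ge0// ltW.
apply: le_trans (enormD _ _) _; rewrite mulrDl lerD//; last first.
  by rewrite enormN mu_bound.
by rewrite -uv.
Qed.

Lemma prox_sq k v : dotp (M1 k *m v) (M1 k *m v) <= mu ^+ 2 * dotp v v.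
Proof. exact/enorm_le_sq/mu_bound. Qed.

Lemma stationarity_error k :
  dotp (w k + grad h (x k.+1)) (w k + grad h (x k.+1))
    <= prev_coef * dotp (d k) (d k).
Proof.
rewrite /prev_coef /w /grad_point; case: alg.
  have -> : - grad h (x k.+1) - M1 k *m d k + grad h (x k.+1) = - (M1 k *m d k).
    by rewrite addrAC addNr add0r.
  by rewrite dotpNl dotpNr opprK prox_sq.
apply: (@grad_prox_sq k (x k.+1) (x k)) => //.
by rewrite addrC addrA.
Qed.

Lemma dual_change_sq k :
  dotp (w k.+1 - w k) (w k.+1 - w k) <=
    2 * next_coef * dotp (d k.+1) (d k.+1) + 2 * prev_coef * dotp (d k) (d k).
Proof.
have [a [b [-> ab bb]]] : exists a b, [/\ w k.+1 - w k = a + b,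
    dotp a a <= next_coef * dotp (d k.+1) (d k.+1) &
    dotp b b <= prev_coef * dotp (d k) (d k)].
  rewrite /next_coef /prev_coef /w /grad_point; case: alg.
    exists (grad h (x k.+1) - grad h (x k.+2) - M1 k.+1 *m d k.+1),
      (M1 k *m d k); split.
    - apply/colP => i; rewrite !mxE; ring.
    - apply: (@grad_prox_sq k.+1 (x k.+1) (x k.+2)) => //.
      by rewrite -enormN opprB.
    - exact: prox_sq.
  exists (- (M1 k.+1 *m d k.+1)),
    (- (grad h (x k.+1) - grad h (x k) - M1 k *m d k)); split.
  - by apply/colP => i; rewrite !mxE; ring.
  - by rewrite dotpNl dotpNr opprK prox_sq.
  - by rewrite dotpNl dotpNr opprK; exact: grad_prox_sq.
by apply: le_trans (sq_addr_le _ _) _; lra.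
Qed.

Let gz k := fine (g (z k)).

Lemma g_finite k : g (z k.+1) = (gz k.+1)%:E.
Proof.
case: (hgen k) => zmin _ _; case: g_proper => gNy [u gu].
rewrite /gz fineK// fin_numE gNy/=.
have := zmin u; rewrite /z_objective; have := gNy u.
case: (g u) gu => // a _ _; rewrite -EFinD.
by case: (g (z k.+1)).
Qed.

(** The three arguments vary independently because the three steps of an
    iteration change them one at a time. *)
Definition lagrangian a b c : R := fine (g b) + h a + dotp c (A *m a - b)
  + r / 2 * dotp (A *m a - b) (A *m a - b).

Lemma z_step k :
  lagrangian (x k.+1) (z k.+2) (y k.+1) <= lagrangian (x k.+1) (z k.+1) (y k.+1).
Proof.
case: (hgen k.+1) => zmin _ _; have := zmin (z k.+1).
rewrite /z_objective !g_finite -!EFinD lee_fin subrr !sqr_enorm.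
have -> : mxsqnorm (M2 k.+1) 0 = 0 by rewrite /mxsqnorm dotpC dotp0l.
have : 0 <= mxsqnorm (M2 k.+1) (z k.+2 - z k.+1).
  by case: (M2_psd k.+1) => _ /(_ (z k.+2 - z k.+1)); rewrite mxsqnorm0.
by rewrite /lagrangian -/(gz k.+1) -/(gz k.+2); lra.
Qed.

(** The quadratic part of the [x]-objective is expanded exactly around its
    minimizer and only [h] is estimated; comparing objective values instead
    would lose half of the proximal term and all of the penalty term. For the algorithm with the exact [h]
    the gradient is taken at the new point, hence the lower descent estimate. *)
Lemma x_step k :
  lagrangian (x k.+1) (z k.+1) (y k) <= lagrangian (x k) (z k.+1) (y k)
    - (mxsqnorm (2 *: M1 k + r *: (A^T *m A)) (d k) - L * dotp (d k) (d k)) / 2.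
Proof.
have desc : h (x k.+1) <= h (x k) + dotp (grad h (grad_point k)) (d k)
    + L / 2 * dotp (d k) (d k).
  rewrite /grad_point; case: alg.
    have := descent_lower h_diff h_grad (x k.+1) (x k).
    have -> : x k - x k.+1 = - d k by rewrite opprB.
    by rewrite !dotpNr dotpNl opprK; lra.
  exact: descent_upper.
have stat : dotp (grad h (grad_point k)) (d k) + dotp (M1 k *m d k) (d k)
    + dotp (y k) (A *m d k) + r * dotp (res k.+1) (A *m d k) = 0.
  have := congr1 (fun v => dotp v (d k)) (x_step_stationary k).
  rewrite -/(res k.+1) /= [LHS]dotp_mulmxl trmxK dotpDl dotpZl /w.
  rewrite [X in _ = X]dotpDl !dotpNl; lra.
have resE : A *m x k - z k.+1 = res k.+1 - A *m d k.
  by rewrite /res /d mulmxBr opprB addrACA addrC addrA subrK addrC.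
rewrite /lagrangian resE -/(res k.+1) /mxsqnorm.
move: desc stat; move: (d k) (res k.+1) => d0 q desc stat.
rewrite mulmxDl -!scalemxAl -mulmxA !dotpE [dotp (A^T *m _) _]dotp_mulmxl trmxK.
by rewrite (dotpC (A *m d0) q); lra.
Qed.

Lemma y_step k : lagrangian (x k.+1) (z k.+1) (y k.+1) =
  lagrangian (x k.+1) (z k.+1) (y k)
    + dotp (y k.+1 - y k) (y k.+1 - y k) / (rho * r).
Proof.
rewrite /lagrangian -/(res k.+1).
have -> : y k.+1 - y k = (rho * r) *: res k.+1 by rewrite yE addrAC subrr add0r.
rewrite yE dotpDl !dotpZl dotpZr; move: (res k.+1) => q.
by field; rewrite gt_eqF// gt_eqF.
Qed.

Let tau1 := relax_memory rho.
Let t0 := T0 A rho.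

(** The augmented Lagrangian alone may increase; the two corrections store the
    terms that telescope in the estimate of the multiplier step. *)
Definition merit k : R := lagrangian (x k.+1) (z k.+1) (y k.+1)
  + tau1 / (lam * r) * dotp (p k) (p k)
  + 2 * prev_coef * t0 / r * dotp (d k) (d k).

Lemma multiplier_step_sq k :
  dotp (y k.+2 - y k.+1) (y k.+2 - y k.+1) / (rho * r) <=
    tau1 / (lam * r) * (dotp (p k) (p k) - dotp (p k.+1) (p k.+1))
    + t0 / r * dotp (w k.+1 - w k) (w k.+1 - w k).
Proof.
have := relax_step rho02 (increment_relaxation k).
rewrite -/tau1 => step.
have := lambda_min_gram A (y k.+2 - y k.+1); rewrite -/lam -/(p k.+1) => lamP.
have ai : 0 < (lam * r)^-1 by rewrite invr_gt0 mulr_gt0.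
have lamn : lam != 0 by rewrite gt_eqF.
have rn : r != 0 by rewrite gt_eqF.
have rhon : rho != 0 by rewrite gt_eqF.
rewrite /t0 T0_relax_input -/lam.
have ri : 0 <= (rho * (lam * r))^-1 by rewrite invr_ge0 !mulr_ge0// ltW.
have := ler_wpM2l ri lamP.
have := ler_wpM2l (ltW ai) step.
set D := dotp (w k.+1 - w k) _; set P' := dotp (p k.+1) _.
set P := dotp (p k) _; set Y := dotp (y k.+2 - y k.+1) _.
have -> : (rho * (lam * r))^-1 * (lam * Y) = Y / (rho * r).
  by field; rewrite lamn rn rhon.
have -> : (rho * (lam * r))^-1 * P' = (lam * r)^-1 * (P' / rho).
  by field; rewrite lamn rn rhon.
have -> : relax_input rho / lam / r = relax_input rho / (lam * r).
  by rewrite -mulrA -invfM.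
lra.
Qed.

(** The condition on [2 M_1^k + r A^T A] makes the decrease of the [x]-step pay
    for the increase of the multiplier step. *)
Lemma merit_decreases k : merit k.+1 <= merit k.
Proof.
have [_ _ _ [_ _ _ /(_ k.+1 (d k.+1))]] := hA.
rewrite -/mu C_M_coefs -/t0 [X in X <= _]/mxsqnorm mul_scalar_mx dotpZl => curv.
have := z_step k; have := x_step k.+1; have := y_step k.+1.
have := multiplier_step_sq k; have := dual_change_sq k.
have t0r : 0 <= t0 / r by rewrite divr_ge0// ltW.
move=> /(ler_wpM2l t0r).
have : 0 <= t0 / r * (prev_coef * dotp (d k.+1) (d k.+1)).
  by rewrite !mulr_ge0 ?prev_coef_ge0 ?dotp_ge0 ?invr_ge0 ?ltW.
move: curv; rewrite /merit.
lra.
Qed.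

(** * Lower bound for the merit function *)

Section LowerBound.
Variables (cg ch : R).
Hypothesis cg_le : forall v, (cg%:E <= g v)%E.
Hypothesis ch_le : forall v, ch <= h v.

(* Half of the corrections in the merit function; the other half compensates
   the negative term - |y|^2 / (2 r) of the Lagrangian. *)
Let slack k := tau1 / (2 * lam * r) * dotp (p k) (p k)
  + t0 / r * (prev_coef * dotp (d k) (d k)).

Lemma slack_ge0 k : 0 <= slack k.
Proof.
rewrite /slack addr_ge0// !mulr_ge0 ?dotp_ge0 ?prev_coef_ge0 ?relax_memory_ge0//.
- by rewrite invr_ge0 !mulr_ge0// ltW.
- exact: ltW.
- by rewrite invr_ge0 ltW.
Qed.

(** By [relax_bound], [|A^T y|^2] is controlled by the corrections and by
    [|grad h|^2], and the latter by [2 L (h - ch)]; the hypothesis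
    [4 T0 L <= r] leaves only half of [h - ch]. *)
Lemma multiplier_sq k : dotp (y k.+1) (y k.+1) / (2 * r) <=
  slack k + (h (x k.+1) - ch) / 2.
Proof.
have ri : 0 <= (2 * (lam * r))^-1 by rewrite invr_ge0 !mulr_ge0// ltW.
have lamn : lam != 0 by rewrite gt_eqF.
have rn : r != 0 by rewrite gt_eqF.
have := ler_wpM2l ri (lambda_min_gram A (y k.+1)); rewrite -/lam.
have := ler_wpM2l ri (relax_bound rho02 (multiplier_from_increment k)).
rewrite -/tau1.
have t0r : 0 <= t0 / r by rewrite divr_ge0// ltW.
have w2 : dotp (w k) (w k) <= 2 * (prev_coef * dotp (d k) (d k))
    + 2 * dotp (grad h (x k.+1)) (grad h (x k.+1)).
  have := stationarity_error k.
  have := sq_addr_le (w k + grad h (x k.+1)) (- grad h (x k.+1)).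
  by rewrite addrK dotpNl dotpNr opprK; lra.
have := ler_wpM2l t0r w2.
have := ler_wpM2l t0r (grad_sq_le h_diff h_grad (x k.+1) L_gt0 ch_le).
have : t0 / r * (2 * L * (h (x k.+1) - ch)) <= (h (x k.+1) - ch) / 2.
  rewrite mulrA [leRHS]mulrC ler_wpM2r ?subr_ge0//.
  have [_ _ _ [_ _ /andP[_ tL] _]] := hA.
  by rewrite mulrAC ler_pdivrMr// -/t0; move: tL; rewrite -/t0; lra.
rewrite /slack; set H := dotp (grad h _) _; set W := dotp (w k) _.
set Y := dotp (y k.+1) _; set P := dotp (p k) _; set Y' := dotp (_ *m y k.+1) _.
have -> : (2 * (lam * r))^-1 * (lam * Y) = Y / (2 * r).
  by field; rewrite rn lamn.
have -> : (2 * (lam * r))^-1 * (tau1 * P + relax_input rho * W) =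
    tau1 / (2 * lam * r) * P + t0 / r * W / 2.
  by rewrite /t0 T0_relax_input -/lam; field; rewrite rn lamn.
lra.
Qed.

Let shifted_res k := res k + r^-1 *: y k.

(** Completing the square in the augmented Lagrangian leaves
    [- |y|^2 / (2 r)]; half of the regularizing terms and half of [h] suffice
    to absorb it. *)
Lemma merit_lower_bound k :
  (gz k.+1 - cg) + (h (x k.+1) - ch) / 2
    + r / 2 * dotp (shifted_res k.+1) (shifted_res k.+1) + slack k
  <= merit k - cg - ch.
Proof.
have := multiplier_sq k; rewrite /merit /lagrangian -/(gz k.+1) -/(res k.+1).
rewrite /shifted_res.
have -> : tau1 / (lam * r) = 2 * (tau1 / (2 * lam * r)).
  by field; rewrite !gt_eqF.
rewrite /slack; move: (res k.+1) (y k.+1) (p k) (d k) => q c p0 d0.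
have -> : r / 2 * dotp (q + r^-1 *: c) (q + r^-1 *: c) =
    r / 2 * dotp q q + dotp c q + dotp c c / (2 * r).
  by rewrite !dotpE (dotpC q c); field; rewrite gt_eqF.
lra.
Qed.

Let E := merit 0 - cg - ch.

Lemma merit_le k : merit k <= merit 0.
Proof. by elim: k => // k IHk; exact: le_trans (merit_decreases k) IHk. Qed.

Lemma iterates_bounds k :
  [/\ gz k.+1 <= E + cg, h (x k.+1) <= 2 * E + ch,
      dotp (shifted_res k.+1) (shifted_res k.+1) <= 2 / r * E
    & dotp (y k.+1) (y k.+1) <= 2 * r * E].
Proof.
have := merit_lower_bound k; have := multiplier_sq k.
have := slack_ge0 k; have := merit_le k.
have := ch_le (x k.+1); have := cg_le (z k.+1).
rewrite g_finite lee_fin => g1 h1 m1 s0 y1 lb.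
have q0 : 0 <= r / 2 * dotp (shifted_res k.+1) (shifted_res k.+1).
  by rewrite mulr_ge0 ?dotp_ge0// divr_ge0// ltW.
rewrite /E; split; [lra|lra| |].
- rewrite -[2 / r]invf_div ler_pdivlMl ?divr_gt0//; lra.
- rewrite -ler_pdivrMl ?mulr_gt0// mulrC; lra.
Qed.

End LowerBound.

Lemma multipliers_bounded : exists C, forall k, enorm (y k) <= C.
Proof.
have [[[cg cg_le] [ch ch_le]] _ _ _] := hA.
apply: bounded_up_to_index.
have [E hE] : exists E, forall k, dotp (y k.+1) (y k.+1) <= E.
  by eexists => k; have [_ _ _] := iterates_bounds cg_le ch_le k; apply.
by exists (Num.sqrt E) => k; rewrite ler_wsqrtr.
Qed.

Lemma residuals_bounded : exists C, forall k, enorm (res k) <= C.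
Proof.
have [[[cg cg_le] [ch ch_le]] _ _ _] := hA.
have [Cy yC] := multipliers_bounded; apply: bounded_up_to_index.
pose E := 2 / r * (merit 0 - cg - ch).
exists (Num.sqrt E + r^-1 * Cy) => k.
rewrite -(addrK (r^-1 *: y k.+1) (res k.+1)).
apply: le_trans (enormD _ _) _; rewrite enormN enormZ lerD//.
  by rewrite ler_wsqrtr//; have [] := iterates_bounds cg_le ch_le k.
by rewrite ger0_norm ?invr_ge0 ?(ltW r_gt0)// ler_wpM2l// invr_ge0 ltW.
Qed.

Lemma g_values_bounded : exists E, forall k, (g (z k.+1) <= E%:E)%E.
Proof.
have [[[cg cg_le] [ch ch_le]] _ _ _] := hA.
eexists => k; have [+ _ _ _] := iterates_bounds cg_le ch_le k.
by rewrite g_finite lee_fin; apply.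
Qed.

Lemma h_values_bounded : exists E, forall k, h (x k.+1) <= E.
Proof.
have [[[cg cg_le] [ch ch_le]] _ _ _] := hA.
by eexists => k; have [_ + _ _] := iterates_bounds cg_le ch_le k; apply.
Qed.

End Iteration.

(** * From bounded values to bounded iterates *)

Lemma coercive_bounded (R : realType) N (f : 'cV[R]_N -> \bar R) (E : R)
    (s : nat -> 'cV[R]_N) :
  coercive f -> (forall k, (f (s k) <= E%:E)%E) ->
  exists C, forall k, enorm (s k) <= C.
Proof.
move=> /(_ E)[b fb] sE; exists b => k; rewrite leNgt; apply/negP => /fb.
by rewrite ltNge sE.
Qed.

Lemma mulmx_inj_bounded_below (R : realType) m n (A : 'M[R]_(m, n)) :
  injective (fun u : 'cV[R]_n => A *m u) ->
  exists2 K, 0 <= K & forall u, enorm u <= K * enorm (A *m u).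
Proof.
move=> Ainj.
have Afull : row_full A.
  rewrite -cokermx_eq0; apply/eqP/matrixP => i j.
  have /Ainj /colP/(_ i) : A *m col j (cokermx A) = A *m 0.
    by rewrite colE mulmxA mulmx_coker mul0mx mulmx0.
  by rewrite !mxE.
have [K K0 BK] := mulmx_bounded (pinvmx A).
by exists K => // u; have := BK (A *m u); rewrite mulmxA mulVpmx// mul1mx.
Qed.

Theorem theorem6 (R : realType) (m n : nat) (alg : algorithm)
  (g : 'cV[R]_m -> \bar R) (h : 'cV[R]_n -> R) (A : 'M[R]_(m, n))
  (M1 : nat -> 'M[R]_n) (M2 : nat -> 'M[R]_m) (L r rho : R)
  (x : nat -> 'cV[R]_n) (z y : nat -> 'cV[R]_m)
  (g_proper : proper_fun g) (g_lsc : lower_semicontinuous g)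
  (h_diff : forall u, differentiable h u) (h_grad : lipschitz_grad h L)
  (M1_psd : forall k, sym_psd (M1 k)) (M2_psd : forall k, sym_psd (M2 k))
  (hA : assumptionA alg g h A M1 M2 L r rho)
  (hgen : generated_by alg g h A M1 M2 r rho x z y)
  (hB : (bijective (fun u : 'cV[R]_n => A *m u) /\ coercive g) \/
        coercive (EFin \o h)) :
  bounded_triples x z y.
Proof.
have [Cy yC] :=
  multipliers_bounded g_proper h_diff h_grad M1_psd M2_psd hA hgen.
have [Cr resC] :=
  residuals_bounded g_proper h_diff h_grad M1_psd M2_psd hA hgen.
suff [Cx xC] : exists C, forall k, enorm (x k) <= C.
  have [K K0 AK] := mulmx_bounded A.
  have zC k : enorm (z k) <= K * Cx + Cr.
    rewrite -(subKr (A *m x k) (z k)); apply: le_trans (enormD _ _) _.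
    rewrite enormN lerD// (le_trans (AK _))// ler_wpM2l//.
  exists (Num.sqrt (Cx ^+ 2 + ((K * Cx + Cr) ^+ 2 + Cy ^+ 2))) => k.
  have sq N (u : 'cV[R]_N) b : enorm u <= b -> dotp u u <= b ^+ 2.
    by move=> ub; rewrite -enorm_le// (le_trans (enorm_ge0 u)).
  by rewrite ler_wsqrtr// !dotp_col_mx !lerD// sq.
case: hB => [[Abij g_coer]|h_coer].
  have [E gE] := g_values_bounded g_proper h_diff h_grad M1_psd M2_psd hA hgen.
  have /bounded_up_to_index[Cz zC] := coercive_bounded g_coer gE.
  have [K K0 AK] := mulmx_inj_bounded_below (bij_inj Abij).
  exists (K * (Cr + Cz)) => k; apply: le_trans (AK _) _.
  rewrite ler_wpM2l// -(subrK (z k) (A *m x k)).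
  by apply: le_trans (enormD _ _) _; rewrite lerD.
have [E hE] := h_values_bounded g_proper h_diff h_grad M1_psd M2_psd hA hgen.
apply: bounded_up_to_index; apply: (coercive_bounded h_coer (E := E)) => k.
by rewrite lee_fin.
Qed.
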